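(* Let $1\le p<\infty$ and let $\Lambda=(\lambda_k)_k\subset\mathbb{N}$ be a strictly increasing infinite sequence with $\sum_k\frac{1}{\lambda_k}<\infty$. If $\phi$ is a real-exponent polynomial with $\phi([0,1])\subset[0,1]$ and with more than one term, then $C_\phi M^p_\Lambda\nsubseteq M^p_\Lambda$.
   Context: $L^p=L^p([0,1])$ with respect to Lebesgue measure. The Müntz space $M^p_\Lambda$ is the closed linear span of $\{x^{\lambda}:\lambda\in\Lambda\}$ in $L^p$; its elements are (represented by) functions continuous on $[0,1)$. If $0\in\Lambda$, the corresponding term is omitted from $\sum 1/\lambda_k$. A real-exponent polynomial is a function of the form $c_1x^{s_1}+\dots+c_lx^{s_l}$ with $c_i\in\mathbb{R}$ and $s_i\in\mathbb{R}^+=(0,\infty)$; its terms are the monomials (with distinct exponents) that appear with nonzero coefficient. The composition operator is $C_\phi f=f\circ\phi$. The relation $C_\phi M^p_\Lambda\nsubseteq M^p_\Lambda$ means that there is $f\in M^p_\Lambda$ with $f\circ\phi\notin M^p_\Lambda$. *)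

(* Defs.v *)
From HB Require Import structures.
From mathcomp Require Import all_boot all_order all_algebra.
From mathcomp Require Import all_classical all_reals all_analysis.

Set Implicit Arguments.
Unset Strict Implicit.
Unset Printing Implicit Defensive.

Import Order.TTheory GRing.Theory Num.Theory.
Import numFieldNormedType.Exports.

Local Open Scope classical_set_scope.
Local Open Scope ring_scope.

(* A function on [0, 1] is encoded as a function on the whole line of which
   only the restriction to [0, 1] matters: the restriction is extended by 0
   before the L^p notions of the library are applied. *)
Definition Lp01 (R : realType) (p : R) : set (R -> R) :=
  [set f | f \_ `[0, 1] \in Lfun (@lebesgue_measure R) p%:E].

Definition Lp01_norm (R : realType) (p : R) (f : R -> R) : \bar R :=
  'N[ @lebesgue_measure R ]_p%:E [ EFin \o (f \_ `[0, 1]) ].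

Definition monomial_span (R : realType) (L : set nat) : set (R -> R) :=
  [set g | exists (n : nat) (c : 'I_n -> R) (e : 'I_n -> nat),
     (forall i, L (e i)) /\ g = fun x => \sum_(i < n) c i * x ^+ e i].

(* A set of Borel functions rather than of L^p classes; among functions that
   are measurable on [0, 1], membership is invariant under almost everywhere
   equality on [0, 1]. *)
Definition muntz_space (R : realType) (p : R) (L : set nat) : set (R -> R) :=
  [set f | Lp01 p f /\
     forall eps : R, 0 < eps ->
       exists2 g, monomial_span L g &
         (Lp01_norm p (fun x => f x - g x)%R < eps%:E)%E].

(* As the exponents are distinct and the coefficients nonzero, l is the number
   of terms of phi. *)
Definition real_exponent_polynomial (R : realType) (l : nat) (phi : R -> R) :
    Prop :=
  exists (c s : 'I_l -> R),
    [/\ forall i, c i != 0, forall i, 0 < s i, injective s &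
        {in `[0, 1], phi =1 fun x => \sum_(i < l) c i * x `^ s i}].

(* C_phi M is not a subset of M.  The operator acts on the representative that
   is continuous on [0, 1[, whereas f \o phi need only be compared with M
   as an L^p class. *)
Definition composition_not_stable (R : realType) (phi : R -> R)
    (M : set (R -> R)) : Prop :=
  exists f : R -> R,
    [/\ M f, {within `[0, 1[, continuous f} & ~ M (f \o phi)].

(* Main.v *)
Require Import Defs.
From mathcomp Require Import all_boot all_order all_algebra.
From mathcomp Require Import all_classical all_reals all_analysis.
From mathcomp Require Import measurable_realfun.
From mathcomp Require Import zify ring lra.

(** Suppose that composition with [phi] maps the Muntz space into itself. For
    every exponent [n] of [Lambda] the monomial [x ^ n] is in the space, hence
    so is [phi ^ n], which is again a finite sum of real powers of [x]. Two
    facts are then in conflict.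

    Rigidity: a finite sum of real powers that lies in the Muntz space has all
    its exponents in [Lambda] ([muntz_exponent]). This is the theorem of Muntz
    in the form: a power [x ^ e] with [e] not in [Lambda] is at positive
    distance from the span of finitely many other powers and of those with
    exponent in [Lambda]. The L^p norm on [0, 1] is bounded below by the L^1
    norm, thus by the sup norm and by the L^2 norm of the primitive vanishing
    at 0. On generalized polynomials the square of the L^2 norm is an explicit
    quadratic form, the sum of the [a_i a_j / (z_i + z_j)] where [z_i] is the
    exponent plus 1/2, and this form decreases when every [a_i] is multiplied
    by the Blaschke factor [(z_i - l) / (z_i + l)], because the difference is a
    positive multiple of a square ([gram_blaschke]). Killing one by one all the
    exponents but [e] gives the classical lower bound, the product of the
    factors [(e - l) / (e + l + 3)] ([gram_ge]), and as the sum of the [1 /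
    lambda_k] converges this product does not tend to 0 ([prod_factor_ge]).

    Abundance: write [phi = a x ^ s + v] where the least exponent in [v] is [s
    + d] with [d > 0]. The coefficient of [x ^ (n s + j d)] in [phi ^ n] is [a
    ^ n] times a polynomial in [n] of degree exactly [j], so it is nonzero for
    all large [n] ([gcoef_gbinom_neq0]). Therefore [n s + j d] is in [Lambda]
    for every large [n] in [Lambda], and for every [n] if [j = 0]. Iterating [n
    |-> n s] in the integers forces [s] to be an integer
    ([integral_powers_nat]), and then so is [d]. Reading the numbers [j] as
    digits in base [s] shows that, starting from one [n], [Lambda] contains all
    the [n s ^ m + t d] with [t < s ^ m] (all the [n + t d] if [s = 1]). Each
    of these progressions contributes a fixed positive amount to the sum of the
    [1 / lambda_k], which cannot converge ([affine_closed_dense]). *)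

Set Implicit Arguments.
Unset Strict Implicit.
Unset Printing Implicit Defensive.

Import Order.TTheory GRing.Theory Num.Theory.
Import numFieldNormedType.Exports.

Local Open Scope classical_set_scope.
Local Open Scope ring_scope.

(** * A lower bound for the Cauchy quadratic form *)

Section CauchyForm.
Context (R : realFieldType).
Implicit Types (r : seq (R * R)) (m : R * R) (e z l : R).

(** A list of pairs (coefficient, exponent) stands for a finite sum of real
    powers. Exponents may repeat, so that sums are concatenations; the
    coefficient of a power is then itself a sum. *)
Definition gcoef r e : R := \sum_(m <- r | m.2 == e) m.1.

Lemma gcoef_cat r r' e : gcoef (r ++ r') e = gcoef r e + gcoef r' e.
Proof. by rewrite /gcoef big_cat. Qed.

Lemma gcoef_notin r e : {in r, forall m, m.2 != e} -> gcoef r e = 0.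
Proof.
by move=> re; rewrite /gcoef big_seq_cond big1// => m /andP[/re/negbTE ->].
Qed.

(** This is the integral of [(\sum a_i exp (- z_i t)) ^ 2] over the half-line,
    or of [(\sum a_i x ^ (z_i - 1/2)) ^ 2] over the unit interval, when all the
    [z_i] are positive. *)
Definition gram r : R :=
  \sum_(m <- r) \sum_(m' <- r) m.1 * m'.1 / (m.2 + m'.2).

Definition blaschke l r : seq (R * R) :=
  [seq (m.1 * ((m.2 - l) / (m.2 + l)), m.2) | m <- r].

(** Multiplication by a Blaschke factor is an isometry of the Hardy space, and
    this is its adjoint: a contraction, whose defect has rank one. It rests on
    the identity [1 - (z - l) (z' - l) / ((z + l) (z' + l)) = 2 l (z + z') /
    ((z + l) (z' + l))], in which the factor [z + z'] cancels the denominator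
    of the form. *)
Lemma gram_blaschke l r : 0 < l -> {in r, forall m, 0 < m.2} ->
  gram (blaschke l r) = gram r - 2 * l * (\sum_(m <- r) m.1 / (m.2 + l)) ^+ 2.
Proof.
move=> l0 r0; rewrite /gram /blaschke big_map expr2 mulr_suml mulr_sumr.
rewrite -sumrB big_seq [RHS]big_seq; apply: eq_bigr => m mr.
rewrite big_map !mulr_sumr -sumrB big_seq [RHS]big_seq.
apply: eq_bigr => m' m'r /=; have := r0 _ mr; have := r0 _ m'r.
by move=> h h'; field; rewrite !gt_eqF// addr_gt0.
Qed.

Lemma gcoef_blaschke l r z :
  gcoef (blaschke l r) z = gcoef r z * ((z - l) / (z + l)).
Proof.
rewrite /gcoef /blaschke big_map mulr_suml /=.
by apply: eq_bigr => m /eqP ->.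
Qed.

Lemma gram_single z r : {in r, forall m, (m.1 == 0) || (m.2 == z)} ->
  gram r = gcoef r z ^+ 2 / (2 * z).
Proof.
move=> rz; rewrite /gram /gcoef expr2 mulr_suml mulr_suml [RHS]big_mkcond.
rewrite big_seq [RHS]big_seq; apply: eq_bigr => m mr.
case: ifPn => mz; last first.
  have := rz _ mr; rewrite (negbTE mz) orbF => /eqP ->.
  by rewrite big1// => i _; rewrite !mul0r.
rewrite mulr_sumr mulr_suml [RHS]big_mkcond.
rewrite big_seq [RHS]big_seq; apply: eq_bigr => m' mr'.
case: ifPn => mz'; last first.
  have := rz _ mr'; rewrite (negbTE mz') orbF => /eqP ->.
  by rewrite mulr0 mul0r.
by rewrite (eqP mz) (eqP mz') mulr_natl mulr2n.
Qed.

(** Each contraction by the Blaschke factor of [l] annihilates the terms of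
    exponent [l]; once every [l] of the list is used up, only the exponent [z]
    survives and the form is explicit. The terms already annihilated remain in
    the list, whence the alternative [m.1 == 0]. *)
Lemma gram_ge z (L : seq R) r : 0 < z -> {in L, forall l, 0 < l} ->
  {in r, forall m, 0 < m.2} ->
  {in r, forall m, (m.1 == 0) || (m.2 \in z :: L)} ->
  (gcoef r z * \prod_(l <- L) ((z - l) / (z + l))) ^+ 2 / (2 * z) <= gram r.
Proof.
move=> z0; elim: L r => [|l L IH] r L0 r0 rL.
  rewrite big_nil mulr1 -gram_single// => m /rL.
  by rewrite inE.
have l0 : 0 < l by apply: L0; rewrite mem_head.
apply: (@le_trans _ _ (gram (blaschke l r))); last first.
  rewrite gram_blaschke// lerBlDr lerDl mulr_ge0 ?sqr_ge0//.
  by rewrite mulr_ge0 ?ltW// ltr0n.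
rewrite big_cons mulrA -gcoef_blaschke; apply: IH.
- by move=> x xL; apply: L0; rewrite inE xL orbT.
- by move=> _ /mapP[m mr ->]/=; exact: r0.
- move=> _ /mapP[m mr ->]/=; have := rL _ mr.
  rewrite !inE => /orP[/eqP ->|]; first by rewrite mul0r eqxx.
  case/or3P => [->|/eqP->|->]; rewrite ?orbT//.
  by rewrite subrr mul0r mulr0 eqxx.
Qed.

End CauchyForm.

(** * Generalized polynomials as functions *)

Section GeneralizedPolynomials.
Context (R : realType).
Implicit Types (r v : seq (R * R)) (m : R * R) (e x z l : R).
Local Notation mu := (@lebesgue_measure R).

Definition geval r x : R := \sum_(m <- r) m.1 * x `^ m.2.

Definition gmul r r' : seq (R * R) :=
  [seq (m.1 * m'.1, m.2 + m'.2) | m <- r, m' <- r'].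

Definition gprim r : seq (R * R) :=
  [seq (m.1 / (m.2 + 1), m.2 + 1) | m <- r].

Lemma geval_cons m r x : geval (m :: r) x = m.1 * x `^ m.2 + geval r x.
Proof. by rewrite /geval big_cons. Qed.

Lemma geval_cat r r' x : geval (r ++ r') x = geval r x + geval r' x.
Proof. by rewrite /geval big_cat. Qed.

(** For nonnegative exponents the rule holds at [x = 0] as well, with the
    convention that the power 0 of 0 is 1. *)
Lemma powRD_ge0 x a b : 0 <= a -> 0 <= b -> x `^ (a + b) = x `^ a * x `^ b.
Proof.
rewrite le_eqVlt => /predU1P[<-|a0] b0; first by rewrite add0r powRr0 mul1r.
by rewrite powRD// gt_eqF// ltr_wpDr.
Qed.

Lemma geval_mul r r' x : {in r, forall m, 0 <= m.2} ->
  {in r', forall m, 0 <= m.2} -> geval (gmul r r') x = geval r x * geval r' x.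
Proof.
move=> r0 r0'; rewrite /geval /gmul big_allpairs_dep mulr_suml /=.
rewrite big_seq [RHS]big_seq; apply: eq_bigr => m mr.
rewrite mulr_sumr big_seq [RHS]big_seq; apply: eq_bigr => m' mr'.
rewrite /= powRD_ge0; [by rewrite mulrACA|exact: r0|exact: r0'].
Qed.

Lemma measurable_geval r : measurable_fun setT (geval r).
Proof.
apply: measurable_sum => m; apply: measurable_funM; first exact: measurable_cst.
exact: measurable_powR.
Qed.

Lemma is_derive_gprim r x : 0 < x -> {in r, forall m, 0 <= m.2} ->
  is_derive x 1 (geval (gprim r)) (geval r x).
Proof.
move=> x0; elim: r => [|m r IH] r0.
  have -> : geval (gprim [::]) = cst 0.
    by apply/funext => y; rewrite /geval big_nil.
  exact: is_derive_cst.
have -> : geval (gprim (m :: r)) =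
    (m.1 / (m.2 + 1)) \*: (@powR R ^~ (m.2 + 1)) + geval (gprim r).
  by apply/funext => y; rewrite /= geval_cons.
have r0' : {in r, forall m, 0 <= m.2}.
  by move=> n nr; apply: r0; rewrite inE nr orbT.
have dr := IH r0'.
have dm := is_derive1_powR (m.2 + 1) x0.
have m0 : 0 <= m.2 by apply: r0; rewrite mem_head.
apply: is_derive_eq; rewrite geval_cons; congr (_ + _).
rewrite /GRing.scale /= addrK mulrA divfK// gt_eqF//.
by rewrite (lt_le_trans ltr01)// lerDr.
Qed.

Lemma geval_continuous r x : 0 < x -> {for x, continuous (geval r)}.
Proof.
move=> x0; elim: r => [|m r IH].
  have -> : geval [::] = cst 0 by apply/funext => y; rewrite /geval big_nil.
  exact: cvg_cst.
have -> : geval (m :: r) =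
    (fun y => m.1 * y `^ m.2 + geval r y).
  by apply/funext => y; rewrite /= geval_cons.
apply: cvgD => //; apply: cvgMr.
have dm := is_derive1_powR m.2 x0.
apply: (@differentiable_continuous R R R x (@powR R ^~ m.2)).
by apply/derivable1_diffP; exact: ex_derive.
Qed.

Lemma geval_cvg0 r : {in r, forall m, 0 <= m.2} ->
  geval r x @[x --> 0^'+] --> geval r 0.
Proof.
elim: r => [|m r IH] r0.
  have -> : geval [::] = cst 0 by apply/funext => y; rewrite /geval big_nil.
  exact: cvg_cst.
have -> : geval (m :: r) =
    (fun y => m.1 * y `^ m.2 + geval r y).
  by apply/funext => y; rewrite /= geval_cons.
apply: cvgD; last first.
  by apply: IH => n nr; apply: r0; rewrite inE nr orbT.
apply: cvgMr; have := r0 m (mem_head _ _).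
rewrite le_eqVlt => /predU1P[<-|m0].
  under eq_fun do rewrite powRr0.
  by rewrite powRr0; exact: cvg_cst.
by rewrite powR0 ?gt_eqF//; exact: powR_cvg0.
Qed.

Lemma geval_within r b : 0 < b -> {in r, forall m, 0 <= m.2} ->
  {within `[0, b], continuous (geval r)}.
Proof.
move=> b0 r0; apply/continuous_within_itvP => //; split.
- by move=> x; rewrite in_itv/= => /andP[x0 _]; exact: geval_continuous.
- exact: geval_cvg0.
- by apply: cvg_at_left_filter; exact: geval_continuous.
Qed.

Lemma gprim_ge0 r : {in r, forall m, 0 <= m.2} ->
  {in gprim r, forall m, 0 <= m.2}.
Proof.
by move=> r0 _ /mapP[m mr ->]/=; rewrite addr_ge0// r0.
Qed.

Lemma geval_gprim0 r : {in r, forall m, 0 <= m.2} -> geval (gprim r) 0 = 0.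
Proof.
move=> r0; rewrite /geval big_map big_seq big1// => m mr /=.
by rewrite powR0 ?mulr0// gt_eqF// (lt_le_trans ltr01)// lerDr r0.
Qed.

Lemma geval_gprim_int r b : 0 < b -> {in r, forall m, 0 <= m.2} ->
  (\int[@lebesgue_measure R]_(x in `[0%R, b]) (geval r x)%:E =
   (geval (gprim r) b)%:E)%E.
Proof.
move=> b0 r0; have := @continuous_FTC2 R (geval r) (geval (gprim r)) 0 b b0.
rewrite geval_gprim0// sube0; apply.
- exact: geval_within.
- split.
  + move=> x; rewrite in_itv/= => /andP[x0 _].
    by have h := is_derive_gprim x0 r0; exact: ex_derive.
  + by apply: geval_cvg0; exact: gprim_ge0.
  + by apply: cvg_at_left_filter; exact: geval_continuous.
- move=> x; rewrite in_itv/= => /andP[x0 _].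
  by have h := is_derive_gprim x0 r0; rewrite derive1E derive_val.
Qed.

(** * Lower bounds for the L^p norm *)

Lemma gprim_le r eps b : {in r, forall m, 0 <= m.2} ->
  (\int[mu]_(x in `[0%R, 1%R]) `|geval r x|%:E <= eps%:E)%E ->
  0 < b <= 1 -> `|geval (gprim r) b| <= eps.
Proof.
move=> r0 reps /andP[b0 b1]; rewrite -lee_fin -abse_EFin -geval_gprim_int//.
have mf D : measurable_fun D (fun x => (geval r x)%:E).
  by apply/measurable_EFinP/measurable_funTS; exact: measurable_geval.
apply: le_trans reps; apply: (le_trans (le_abse_integral _ _ _)) => //.
  exact: mf.
apply: ge0_subset_integral => //.
  by apply: measurableT_comp => //; exact: mf.
by apply: subset_itvl; rewrite bnd_simp.
Qed.

(** The terms of the primitive vanishing at 0, each exponent [e + 1] being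
    increased by 1/2: with these values of [z] the form [gram] is the square of
    the L^2 norm of the primitive on the unit interval. *)
Definition gshift r : seq (R * R) :=
  [seq (m.1 / (m.2 + 1), m.2 + 3 / 2) | m <- r].

Lemma gcoef_gshift r e : gcoef (gshift r) (e + 3 / 2) = gcoef r e / (e + 1).
Proof.
rewrite /gcoef /gshift big_map mulr_suml /=.
under eq_bigl do rewrite (inj_eq (addIr _)).
by apply: eq_bigr => m /eqP ->.
Qed.

Lemma gram_gshift r :
  gram (gshift r) = geval (gprim (gmul (gprim r) (gprim r))) 1.
Proof.
rewrite /gram /geval /gshift /gmul !big_map /gprim big_allpairs_dep.
rewrite big_map; apply: eq_bigr => m _; rewrite !big_map.
apply: eq_bigr => m' _ /=; rewrite powR1 mulr1; congr (_ / _).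
by field.
Qed.

(** The primitive [q] of a function of small L^1 norm is uniformly small, and
    [gram (gshift r)] is the integral of [q ^ 2]. The mean value theorem,
    applied to the primitive of [q ^ 2], evaluates this integral at one point.
    *)
Lemma gram_gshift_le r eps : {in r, forall m, 0 <= m.2} ->
  (\int[mu]_(x in `[0%R, 1%R]) `|geval r x|%:E <= eps%:E)%E ->
  gram (gshift r) <= eps ^+ 2.
Proof.
move=> r0 reps; rewrite gram_gshift.
have q0 := gprim_ge0 r0; set q := gprim r in q0 *.
have s0 : {in gmul q q, forall m, 0 <= m.2}.
  move=> _ /allpairsP[[m m'] [mq m'q ->]] /=.
  by rewrite addr_ge0// q0.
have [] := @MVT R (geval (gprim (gmul q q))) (geval (gmul q q)) 0 1 ltr01.
- by move=> x; rewrite in_itv/= => /andP[x0 _]; exact: is_derive_gprim.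
- by apply: geval_within => //; exact: gprim_ge0.
move=> c; rewrite in_itv/= => /andP[c0 c1].
rewrite geval_gprim0// !subr0 mulr1 => ->; rewrite geval_mul// -expr2.
have qc : `|geval q c| <= eps by apply: gprim_le => //; rewrite c0 ltW.
rewrite -[leLHS]real_normK ?num_real// lerXn2r// nnegrE.
exact: le_trans qc.
Qed.

(** A pointwise substitute for the inequality of Holder, which bounds the L^1
    norm by twice the L^p norm when [t] is the L^p norm. *)
Lemma le_Young1 (p t y : R) : 1 <= p -> 0 < t -> 0 <= y ->
  y <= t + t `^ (1 - p) * y `^ p.
Proof.
move=> p1 t0 y0; have [yt|/ltW ty] := leP y t.
  by rewrite (le_trans yt)// lerDl mulr_ge0// powR_ge0.
apply: ler_wpDl; first exact: ltW.
have y_gt0 : 0 < y by apply: lt_le_trans ty.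
rewrite -[leLHS]powRr1//.
have -> : y `^ 1 = y `^ (1 - p) * y `^ p.
  by rewrite -powRD ?subrK// gt_eqF// implybT.
apply: ler_wpM2r; first exact: powR_ge0.
rewrite -[1 - p]opprB !powRN lef_pV2 ?posrE ?powR_gt0//.
by apply: ge0_ler_powR; rewrite ?subr_ge0// nnegrE ltW.
Qed.

Lemma Lp01_norm_powR (p : R) (h : R -> R) : 0 < p ->
  (Lp01_norm p h `^ p =
   \int[mu]_(x in `[0%R, 1%R]) (`|h x| `^ p)%:E)%E.
Proof.
move=> p0; rewrite /Lp01_norm poweR_Lnorm ?gt_eqF// [RHS]integral_mkcond.
apply: eq_integral => x _ /=; rewrite !patchE.
by case: ifPn => //; rewrite normr0 powR0// gt_eqF.
Qed.

Lemma Lp01_norm_int (p eps : R) (h : R -> R) : 1 <= p -> 0 < eps ->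
  measurable_fun setT h -> (Lp01_norm p h < eps%:E)%E ->
  (\int[mu]_(x in `[0%R, 1%R]) `|h x|%:E <= (2 * eps)%:E)%E.
Proof.
move=> p1 eps0 mh hp.
have p0 : 0 < p by exact: lt_le_trans p1.
have hpp : (\int[mu]_(x in `[0%R, 1%R]) (`|h x| `^ p)%:E <= (eps `^ p)%:E)%E.
  rewrite -Lp01_norm_powR// -poweR_EFin; apply: gt0_ler_poweR; rewrite ?ltW//.
  - by rewrite in_itv/= leey Lnorm_ge0.
  - by rewrite in_itv/= leey lee_fin ltW.
apply: (@le_trans _ _ (\int[mu]_(x in `[0%R, 1%R])
    (eps%:E + (eps `^ (1 - p))%:E * (`|h x| `^ p)%:E))%E).
  apply: ge0_le_integral => //.
  - apply/measurable_EFinP/measurable_funTS; exact: measurableT_comp.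
  - apply/measurable_EFinP => /=.
    apply: measurable_funD; first exact: measurable_cst.
    apply: measurable_funM; first exact: measurable_cst.
    apply: measurable_funTS; apply: (measurableT_comp (measurable_powR _)).
    exact: measurableT_comp.
  - by move=> x _; rewrite -EFinM -EFinD lee_fin; exact: le_Young1.
rewrite ge0_integralD//; last 3 first.
- by move=> x _; rewrite lee_fin ltW.
- by move=> x _; rewrite -EFinM lee_fin mulr_ge0// powR_ge0.
- apply/measurable_EFinP => /=.
  apply: measurable_funM; first exact: measurable_cst.
  apply: measurable_funTS; apply: (measurableT_comp (measurable_powR _)).
  exact: measurableT_comp.
rewrite integral_cst//= lebesgue_measure_itv/= lte_fin ltr01 oppr0 adde0 mule1.
rewrite ge0_integralZl//.
- have -> : 2 * eps = eps + eps `^ (1 - p) * eps `^ p.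
    by rewrite -powRD ?subrK ?powRr1 ?ltW// ?gt_eqF ?implybT//; ring.
  rewrite EFinD leeD2l// EFinM lee_wpmul2l// lee_fin powR_ge0//.
- apply/measurable_EFinP/measurable_funTS.
  by apply: (measurableT_comp (measurable_powR _)); exact: measurableT_comp.
- by rewrite lee_fin powR_ge0.
Qed.

Lemma Lp01_norm_ext (p : R) (f g : R -> R) : {in `[0, 1], f =1 g} ->
  Lp01_norm p f = Lp01_norm p g.
Proof.
move=> fg; rewrite /Lp01_norm; congr Lnorm; apply/funext => x /=.
congr (_%:E); rewrite !patchE; case: ifPn => // /set_mem; exact: fg.
Qed.

(** The quantitative form of rigidity. The shifts of the exponents by 3/2
    cancel in the numerators and add up to 3 in the denominators. *)
Lemma geval_norm_ge r e (L : seq R) (p eps : R) : 1 <= p -> 0 < eps ->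
  0 <= e -> {in L, forall l, 0 <= l} -> {in r, forall m, m.2 \in e :: L} ->
  (Lp01_norm p (geval r) < eps%:E)%E ->
  (gcoef r e / (e + 1) * \prod_(l <- L) ((e - l) / (e + l + 3))) ^+ 2
    / (2 * e + 3) <= (2 * eps) ^+ 2.
Proof.
move=> p1 eps0 e0 L0 rL rp.
have r0 : {in r, forall m, 0 <= m.2}.
  by move=> m /rL; rewrite inE => /predU1P[->//|/L0].
have := gram_gshift_le r0 (Lp01_norm_int p1 eps0 (measurable_geval r) rp).
apply: le_trans.
have := @gram_ge _ (e + 3 / 2) [seq l + 3 / 2 | l <- L] (gshift r).
rewrite gcoef_gshift big_map.
have -> : 2 * (e + 3 / 2) = 2 * e + 3 by field.
under eq_bigr => l _.
  have -> : e + 3 / 2 - (l + 3 / 2) = e - l by field.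
  have -> : e + 3 / 2 + (l + 3 / 2) = e + l + 3 by field.
  over.
apply.
- by rewrite ltr_wpDl.
- by move=> _ /mapP[l lL ->]; rewrite ltr_wpDl// L0.
- by move=> _ /mapP[m mr ->] /=; rewrite ltr_wpDl// r0.
- move=> _ /mapP[m mr ->] /=; apply/orP; right.
  have := rL _ mr; rewrite !inE (inj_eq (addIr _)) => /orP[->//|mL].
  by apply/orP; right; apply/mapP; exists m.2.
Qed.

End GeneralizedPolynomials.

(** * Convergence of the sum of reciprocals *)

Section SummableReciprocals.
Context (R : realType).
Implicit Types (e : R) (lam : nat -> nat).

(** The index [N] is positive so that, for an increasing sequence, the tail
    avoids the exponent 0, whose inverse has the value 0. *)
Definition small_tails (lam : nat -> nat) := forall eps : R, 0 < eps ->
  exists2 N, (0 < N)%N &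
    forall n, \sum_(N <= k < n) (lam k)%:R^-1 < eps.

Lemma summable_small_tails (lam : nat -> nat) :
  (forall k, (k <= lam k)%N) ->
  (\sum_(0 <= k <oo | lam k != 0%N) ((lam k)%:R^-1 : R)%:E < +oo)%E ->
  small_tails lam.
Proof.
move=> lamk foo eps eps0.
have u0 k : lam k != 0%N -> (0 <= ((lam k)%:R^-1 : R)%:E)%E.
  by move=> _; rewrite lee_fin invr_ge0 ler0n.
have cv := nneseries_tail_cvg foo u0.
have nb : nbhs (0%E : \bar R) (fun u => (u < eps%:E)%E).
  by apply: open_ereal_lt'; rewrite lte_fin.
have [N _ hN] := cv _ nb.
exists N.+1 => // n; rewrite -lte_fin.
apply: le_lt_trans (hN N.+1 (leqnSn N)).
apply: le_trans (nneseries_lim_ge n _); last by move=> k _; exact: u0.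
rewrite big_nat_cond [in leRHS]big_nat_cond -sumEFin.
rewrite le_eqVlt; apply/orP; left; apply/eqP; apply: eq_bigl => k.
rewrite andbT; case: (boolP (N < k < n)%N) => // /andP[Nk _].
by rewrite -lt0n (leq_trans _ (lamk k))//= (leq_ltn_trans _ Nk).
Qed.

(** The inequality of Weierstrass. *)
Lemma prod_ge1B (I : Type) (s : seq I) (f x : I -> R) :
  (forall i, 0 <= f i <= 1) -> (forall i, 1 - x i <= f i) ->
  1 - \sum_(i <- s) x i <= \prod_(i <- s) f i.
Proof.
move=> f01 xf; have p1 : forall t : seq I, 0 <= \prod_(i <- t) f i <= 1.
  by move=> t; rewrite prodr_ge0 ?prodr_ile1// => i _; case/andP: (f01 i).
elim: s => [|i s IH]; first by rewrite !big_nil subr0.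
rewrite !big_cons; have /andP[f0 f1] := f01 i; have /andP[q0 q1] := p1 s.
have := xf i; nra.
Qed.

(** The absolute value of the factor of [lam k] is at most 1 and at least [1 -
    (2 e + 3) / lam k]. Past some rank [N] these defects sum to at most 1/2, so
    the rest of the product is at least 1/2; the finitely many factors before
    [N] are nonzero as [e] is none of the [lam k]. *)
Lemma prod_factor_ge (lam : nat -> nat) e : 0 <= e ->
  small_tails lam -> (forall k, (k <= lam k)%N) ->
  (forall k, e != (lam k)%:R) ->
  exists2 delta : R, 0 < delta & forall K,
    delta <= `|\prod_(k <- iota 0 K) ((e - (lam k)%:R) / (e + (lam k)%:R + 3))|.
Proof.
move=> e0 tl lamk elam.
pose f k : R := `|(e - (lam k)%:R) / (e + (lam k)%:R + 3)|.
have l0 k : 0 <= (lam k)%:R :> R by rewrite ler0n.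
have d0 k : 0 < e + (lam k)%:R + 3.
  by rewrite ltr_wpDl// addr_ge0.
have f0 k : 0 < f k by rewrite normr_gt0 mulf_neq0 ?invr_eq0 ?subr_eq0// gt_eqF.
have f1 k : f k <= 1.
  rewrite /f normrM normfV (gtr0_norm (d0 k)) ler_pdivrMr// mul1r.
  have := l0 k; have := e0; case: (ger0P (e - (lam k)%:R)) => ?; lra.
have f01 k : 0 <= f k <= 1 by rewrite f1 ltW.
have c0 : 0 < 2 * e + 3 by have := e0; lra.
have [N N0 hN] := tl (2 * (2 * e + 3))^-1 ltac:(by rewrite invr_gt0 mulr_gt0).
have fx k : (0 < lam k)%N -> 1 - (2 * e + 3) * (lam k)%:R^-1 <= f k.
  move=> lk0; have lk : 0 < (lam k)%:R :> R by rewrite ltr0n.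
  rewrite /f -normrN; apply: le_trans (ler_norm _).
  have -> : - ((e - (lam k)%:R) / (e + (lam k)%:R + 3)) =
      1 - (2 * e + 3) / (e + (lam k)%:R + 3).
    by field; rewrite gt_eqF// d0.
  rewrite lerD2l lerN2 ler_pM2l// lef_pV2 ?posrE ?d0//.
  by have := e0; lra.
have p01 (s : seq nat) : 0 <= \prod_(k <- s) f k <= 1.
  by rewrite prodr_ge0 ?prodr_ile1// => k _; case/andP: (f01 k).
exists ((\prod_(k <- iota 0 N) f k) / 2).
  by rewrite divr_gt0// prodr_gt0.
move=> K; rewrite normr_prod -/(f _).
apply: (@le_trans _ _ (\prod_(k <- iota 0 (K + N)) f k)); last first.
  rewrite iotaD big_cat ler_piMr//.
    by case/andP: (p01 (iota 0 K)).
  by case/andP: (p01 (iota (0 + K) N)).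
rewrite addnC iotaD big_cat ler_wpM2l//=.
  by case/andP: (p01 (iota 0 N)).
(* The value 1 below [N] makes the bound trivial where [lam k] may be 0. *)
pose x k : R := if (N <= k)%N then (2 * e + 3) * (lam k)%:R^-1 else 1.
have fx' k : 1 - x k <= f k.
  rewrite /x; case: ifPn => [Nk|_]; last by rewrite subrr ltW.
  by apply: fx; apply: leq_trans (lamk k); apply: leq_trans Nk.
apply: le_trans (prod_ge1B (iota N K) f01 fx').
have -> : iota N K = index_iota N (N + K) by rewrite /index_iota addKn.
rewrite (eq_big_nat _ _ (F2 := fun k => (2 * e + 3) * (lam k)%:R^-1));
  last first.
  by move=> k /andP[Nk _]; rewrite /x Nk.
rewrite -mulr_sumr; have := hN (N + K)%N.
rewrite -(ltr_pM2l c0) => h; have -> : 2^-1 = 1 - 2^-1 :> R by lra.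
rewrite lerD2l lerN2 ltW//; apply: lt_le_trans h _.
by rewrite invfM mulrCA divff ?mulr1// gt_eqF.
Qed.

End SummableReciprocals.

(** * Exponents of the generalized polynomials in a Muntz space *)

Section MuntzSpace.
Context (R : realType).
Implicit Types (r v : seq (R * R)) (m : R * R) (e x z l : R).
Local Notation mu := (@lebesgue_measure R).

(** If [e] were none of the [lam k], then for every [g] in the span the
    difference [f - g] would still have the coefficient of [f] at [e], and its
    norm would be at least a constant independent of [g]: the Blaschke factors
    involved are those of the other exponents of [r], a fixed nonzero product,
    and those of finitely many [lam k], bounded below by [prod_factor_ge]. *)
Lemma muntz_exponent (p : R) (lam : nat -> nat) (f : R -> R) r e :
  1 <= p -> small_tails R lam -> (forall k, (k <= lam k)%N) ->
  {in r, forall m, 0 <= m.2} ->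
  muntz_space p (range lam) f -> {in `[0, 1], f =1 geval r} ->
  gcoef r e != 0 -> exists k, e = (lam k)%:R.
Proof.
move=> p1 tl lamk r0 [_ fM] fr re; apply/not_existsP => elam.
have {}elam k : e != (lam k)%:R by apply/eqP; exact: elam.
have e0 : 0 <= e.
  have [[m /andP[mr /eqP <-]]|none] :=
      pselect (exists m, (m \in r) && (m.2 == e)).
    exact: r0.
  move/eqP: re; rewrite gcoef_notin// => m mr; apply/eqP => me.
  by apply: none; exists m; rewrite mr me eqxx.
have [delta delta0 hdelta] := prod_factor_ge e0 tl lamk elam.
pose L1 := [seq m.2 | m <- r & m.2 != e].
pose D1 := `|\prod_(l <- L1) ((e - l) / (e + l + 3))|.
have D1_gt0 : 0 < D1.
  rewrite normr_gt0 prodf_seq_neq0; apply/allP => _ /mapP[m + ->] /=.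
  rewrite mem_filter => /andP[me mr].
  rewrite mulf_neq0 ?invr_eq0 ?subr_eq0 1?eq_sym// eq_sym gt_eqF//.
  by rewrite ltr_wpDl// addr_ge0// r0.
pose q := `|gcoef r e / (e + 1)| * (D1 * delta).
have q0 : 0 < q.
  by rewrite !mulr_gt0// normr_gt0 mulf_neq0// invr_eq0 gt_eqF// ltr_wpDl.
have c0 : 0 < 2 * e + 3 by have := e0; lra.
(* Any [eps] with [(2 * eps) ^ 2 < q ^ 2 / (2 * e + 3)] contradicts the bound
   of [geval_norm_ge]. *)
have eps0 : 0 < q / (4 * (2 * e + 3)) by rewrite divr_gt0// mulr_gt0.
have [g [n [c [d [dL gE]]]] hg] := fM _ eps0.
pose h := r ++ [seq (- c i, (d i)%:R) | i <- index_enum 'I_n].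
have hh : {in `[0, 1], (fun x => f x - g x) =1 geval h}.
  move=> x x01; rewrite /= fr// geval_cat gE /geval big_map -sumrN.
  congr (_ + _).
  apply: eq_bigr => i _ /=; rewrite powR_mulrn ?mulNr//.
  by move: x01; rewrite in_itv => /andP[].
rewrite (Lp01_norm_ext _ hh) in hg.
have /boolp.choice[kd kdE] : forall i : 'I_n, exists k, d i = lam k.
  by move=> i; have [k _ <-] := dL i; exists k.
have [K kdK] : exists K, forall i, (kd i < K)%N.
  by exists (\max_(i < n) kd i).+1 => i; rewrite ltnS leq_bigmax.
pose L := L1 ++ [seq (lam k)%:R | k <- iota 0 K].
have L0 : {in L, forall l, 0 <= l}.
  move=> l; rewrite mem_cat => /orP[] /mapP[m + ->]; last by rewrite ler0n.
  by rewrite mem_filter => /andP[_ /r0].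
have hL : {in h, forall m, m.2 \in e :: L}.
  move=> m; rewrite mem_cat inE => /orP[mr|/mapP[i _ ->]] /=.
    have [//|me] := eqVneq m.2 e; rewrite /= mem_cat; apply/orP; left.
    by apply/mapP; exists m => //; rewrite mem_filter me.
  rewrite mem_cat; apply/orP; right; apply/orP; right; apply/mapP.
  exists (kd i); rewrite ?kdE// mem_iota /= add0n.
  exact: kdK.
have := geval_norm_ge p1 eps0 e0 L0 hL hg.
have -> : gcoef h e = gcoef r e.
  rewrite gcoef_cat [X in _ + X]gcoef_notin ?addr0// => _ /mapP[i _ ->] /=.
  by rewrite kdE eq_sym.
rewrite -[X in X / (2 * e + 3)]real_normK ?num_real//.
rewrite big_cat /= big_map !normrM -/D1.
set P := `|\prod_(k <- _) _| => hP.
have qP : q <= `|gcoef r e| * `|(e + 1)^-1| * (D1 * P).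
  by rewrite /q normrM ler_wpM2l ?mulr_ge0// ler_wpM2l ?(ltW D1_gt0)// hdelta.
have : q ^+ 2 / (2 * e + 3) <= (2 * (q / (4 * (2 * e + 3)))) ^+ 2.
  apply: le_trans hP; rewrite ler_pM2r ?invr_gt0// lerXn2r// nnegrE.
    exact: ltW.
  exact: le_trans (ltW q0) qP.
have -> : (2 * (q / (4 * (2 * e + 3)))) ^+ 2 =
   q ^+ 2 / (2 * e + 3) * (4 * (2 * e + 3))^-1.
  by field; rewrite gt_eqF.
rewrite ler_pMr; last by rewrite divr_gt0// exprn_gt0.
by rewrite leNgt invf_lt1 ?mulr_gt0//; have := e0; lra.
Qed.

Lemma monomial_muntz (p : R) (L : set nat) n : 1 <= p -> L n ->
  muntz_space p L (fun x : R => x ^+ n).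
Proof.
move=> p1 Ln; have p0 : 0 < p by exact: lt_le_trans p1.
split; last first.
  move=> eps eps0; exists (fun x => x ^+ n).
    exists 1%N, (fun=> 1), (fun=> n); split=> //.
    by apply/funext => x; rewrite big_ord1 mul1r.
  have -> : Lp01_norm p (fun x : R => x ^+ n - x ^+ n) = 0%E.
    rewrite -(@Lnorm0 _ _ _ mu p%:E) ?eqe ?gt_eqF//; congr Lnorm.
    by apply/funext => x /=; rewrite patchE subrr; case: ifP.
  by rewrite lte_fin.
have mX : measurable_fun setT (fun x : R => x ^+ n).
  exact: measurable_funX.
rewrite /Lp01 /=; rewrite inE; apply/andP; split; rewrite inE /=.
  by apply/(measurable_restrictT _ _).1 => //; exact: measurable_funTS.
rewrite /finite_norm; apply: (@lty_poweRy _ _ p); first by rewrite gt_eqF.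
rewrite [X in (X `^ _)%E]/(Lp01_norm p (fun x : R => x ^+ n)) Lp01_norm_powR//.
apply: (@le_lt_trans _ _ (\int[mu]_(x in `[0%R, 1%R]) 1)%E).
  apply: ge0_le_integral => //.
    apply/measurable_EFinP/measurable_funTS.
    by apply: (measurableT_comp (measurable_powR _)); exact: measurableT_comp.
  move=> x /=; rewrite in_itv/= => /andP[x0 x1]; rewrite lee_fin.
  have one_pow : 1 = 1 `^ p :> R by rewrite powR1.
  rewrite [leRHS]one_pow ge0_ler_powR ?nnegrE ?(ltW p0)//.
    by rewrite ger0_norm ?exprn_ge0// exprn_ile1.
by rewrite integral_cst//= mul1e lebesgue_measure_itv/= lte_fin ltr01
  -EFinB ltry.
Qed.

End MuntzSpace.

(** * Coefficients of the powers of a generalized polynomial *)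

Section Powers.
Context (R : realType).
Implicit Types (r v : seq (R * R)) (m : R * R) (e x z l : R).

Definition gpow r n : seq (R * R) := iter n (gmul r) [:: (1, 0)].

Lemma gmul_ge r r' e e' : {in r, forall m, e <= m.2} ->
  {in r', forall m, e' <= m.2} -> {in gmul r r', forall m, e + e' <= m.2}.
Proof.
by move=> re re' _ /allpairsP[[m m'] [mr mr' ->]]; rewrite lerD ?re ?re'.
Qed.

Lemma gpow_ge r e n : {in r, forall m, e <= m.2} ->
  {in gpow r n, forall m, n%:R * e <= m.2}.
Proof.
move=> re; elim: n => [|n IH].
  by move=> m; rewrite inE => /eqP ->; rewrite mul0r.
by rewrite -natr1 mulrDl mul1r addrC; exact: gmul_ge.
Qed.

Lemma geval_gpow r x n : {in r, forall m, 0 <= m.2} ->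
  geval (gpow r n) x = geval r x ^+ n.
Proof.
move=> r0; elim: n => [|n IH].
  by rewrite expr0 /geval big_seq1/= powRr0 mulr1.
rewrite exprS -IH geval_mul// => m mr.
by have := gpow_ge r0 mr; rewrite mulr0.
Qed.

(** The lowest possible exponent of a product arises only from the lowest
    exponents of the factors. *)
Lemma gcoef_gmul_min r r' e e' : {in r, forall m, e <= m.2} ->
  {in r', forall m, e' <= m.2} ->
  gcoef (gmul r r') (e + e') = gcoef r e * gcoef r' e'.
Proof.
move=> re re'; rewrite /gcoef big_mkcond /gmul big_allpairs_dep mulr_suml /=.
rewrite [RHS]big_mkcond [LHS]big_seq [RHS]big_seq; apply: eq_bigr => m mr.
rewrite mulr_sumr -big_mkcond big_seq_cond.
case: eqP => [->|/eqP me]; last first.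
  rewrite big_pred0// => m'; apply/negbTE/negP => /andP[m'r /eqP E].
  have := re _ mr; rewrite le_eqVlt eq_sym (negbTE me)/= => lt.
  by have := re' _ m'r; move: lt E; lra.
rewrite [RHS]big_seq_cond; apply: eq_bigl => m'.
by rewrite (inj_eq (addrI _)).
Qed.

Lemma gcoef_gpow_min r e n : {in r, forall m, e <= m.2} ->
  gcoef (gpow r n) (n%:R * e) = gcoef r e ^+ n.
Proof.
move=> re; elim: n => [|n IH].
  by rewrite mul0r expr0 /gcoef big_mkcond big_seq1/= eqxx.
rewrite exprS -IH -natr1 mulrDl mul1r addrC gcoef_gmul_min//.
exact: gpow_ge.
Qed.

(** The expansion of [(a x ^ s + v) ^ n] by the binomial formula. *)
Definition gbinom (a s : R) v n : seq (R * R) :=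
  flatten [seq [seq ('C(n, k)%:R * a ^+ (n - k) * m.1, s * (n - k)%:R + m.2)
               | m <- gpow v k] | k <- iota 0 n.+1].

Lemma gbinom_ge0 a s v n : 0 <= s -> {in v, forall m, 0 <= m.2} ->
  {in gbinom a s v n, forall m, 0 <= m.2}.
Proof.
move=> s0 v0 _ /flatten_mapP[k _ /mapP[m mv ->]] /=.
rewrite addr_ge0 ?mulr_ge0//.
by have := gpow_ge v0 mv; rewrite mulr0.
Qed.

Lemma geval_gbinom a s v n x : 0 <= s -> {in v, forall m, 0 <= m.2} ->
  geval (gbinom a s v n) x = (a * x `^ s + geval v x) ^+ n.
Proof.
move=> s0 v0; rewrite exprDn /geval /gbinom big_flatten big_map.
rewrite -[iota _ _]/(index_iota 0 n.+1) big_mkord; apply: eq_bigr => k _.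
rewrite big_map -(geval_gpow x k v0) /geval -mulrnAl mulr_sumr.
rewrite big_seq [RHS]big_seq; apply: eq_bigr => m mv /=.
rewrite powRD_ge0 ?mulr_ge0//; last by have := gpow_ge v0 mv; rewrite mulr0.
rewrite powRrM powR_mulrn ?powR_ge0// exprMn -mulr_natl.
by ring.
Qed.

Lemma gcoef_gbinom a s v n e :
  gcoef (gbinom a s v n) (n%:R * s + e) =
  \sum_(k < n.+1) 'C(n, k)%:R * a ^+ (n - k) * gcoef (gpow v k) (k%:R * s + e).
Proof.
rewrite /gcoef /gbinom big_flatten big_map.
rewrite -[iota _ _]/(index_iota 0 n.+1) big_mkord; apply: eq_bigr => k _.
rewrite big_map mulr_sumr; apply: eq_bigl => m /=.
rewrite -subr_eq0 -[RHS]subr_eq0; congr (_ == 0).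
by rewrite natrB ?leq_ord//; ring.
Qed.

(** While [k + 1 <= j], the ratio [(n - k) / (k + 1)] of ['C(n, k.+1)] to
    ['C(n, k)] is at least [M]. *)
Lemma bin_dominates M n j k : (0 < M)%N -> (M * j + j <= n)%N -> (k < j)%N ->
  (M * 'C(n, k) <= 'C(n, j))%N.
Proof.
move=> M0; elim: j => // j IH jn.
have step : (M * 'C(n, j) <= 'C(n, j.+1))%N.
  rewrite -(leq_pmul2l (ltn0Sn j)) mul_bin_left mulnA leq_mul2r.
  by apply/orP; right; rewrite leq_subRL; move: jn; nia.
rewrite ltnS leq_eqVlt => /predU1P[->//|kj].
apply: leq_trans step; apply: leq_trans (leq_pmull _ M0).
by apply: IH => //; apply: leq_trans jn; rewrite mulnS; lia.
Qed.

(** As [g j != 0], the sum is a polynomial in [n] of degree [j] and the term of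
    index [j] prevails for large [n]. The threshold is made proportional to
    [j], so that for [j = 0] it allows every [n]. *)
Lemma binomial_sum_neq0 (g : nat -> R) j : g j != 0 ->
  exists M, forall n, (M * j <= n)%N -> \sum_(k < j.+1) 'C(n, k)%:R * g k != 0.
Proof.
move=> gj; have gj0 : 0 < `|g j| by rewrite normr_gt0.
pose S := \sum_(k < j) `|g k|.
have S0 : 0 <= S by rewrite sumr_ge0.
pose M := (Num.truncn (S / `|g j|)).+1.
have SM : S < M%:R * `|g j|.
  by rewrite -ltr_pdivrMr// truncnS_gt.
exists M.+1 => n; rewrite mulSnr => jn; rewrite big_ord_recr /=.
have Cj : 0 < 'C(n, j)%:R :> R.
  by rewrite ltr0n bin_gt0 (leq_trans _ jn)// leq_addl.
apply/negP; rewrite addr_eq0 => /eqP E.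
have : M%:R * `|\sum_(k < j) 'C(n, k)%:R * g k| <= 'C(n, j)%:R * S.
  apply: (@le_trans _ _ (M%:R * \sum_(k < j) `|'C(n, k)%:R * g k|)).
    by rewrite ler_wpM2l// ler_norm_sum.
  rewrite !mulr_sumr ler_sum// => k _; rewrite normrM normr_nat mulrA.
  by rewrite ler_wpM2r// -natrM ler_nat bin_dominates.
rewrite E normrN normrM normr_nat mulrCA ler_pM2l//.
by rewrite leNgt SM.
Qed.

(** In the expansion along the powers of [v], the power [k] only has exponents
    [>= k (s + d)], so it contributes to the exponent [n s + j d] only if [k <=
    j]. The contribution of [k] is then [a ^ n 'C(n, k)] times a constant
    independent of [n], and for [k = j] this constant comes from the lowest
    coefficient of [v], hence is nonzero. *)
Lemma gcoef_gbinom_neq0 a s d v j : a != 0 ->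
  {in v, forall m, s + d <= m.2} -> 0 < d -> gcoef v (s + d) != 0 ->
  exists M, forall n, (M * j <= n)%N ->
    gcoef (gbinom a s v n) (n%:R * s + j%:R * d) != 0.
Proof.
move=> a0 vsd d0 vc.
pose g k := gcoef (gpow v k) (k%:R * s + j%:R * d) / a ^+ k.
have gj : g j != 0.
  rewrite /g -mulrDr gcoef_gpow_min//.
  by rewrite mulf_neq0 ?invr_eq0 ?expf_neq0.
have [M hM] := binomial_sum_neq0 gj.
exists M.+1 => n; rewrite mulSnr => Mn; rewrite gcoef_gbinom.
have jn : (j.+1 <= n.+1)%N by rewrite ltnS (leq_trans _ Mn)// leq_addl.
rewrite -(big_mkord xpredT (fun k => 'C(n, k)%:R * a ^+ (n - k) *
  gcoef (gpow v k) (k%:R * s + j%:R * d))).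
rewrite (big_cat_nat _ jn)//= [X in _ + X]big_nat [X in _ + X]big1 ?addr0;
  last first.
  move=> k /andP[jk _]; rewrite gcoef_notin ?mulr0// => m mv.
  apply/eqP => E; have := gpow_ge vsd mv; rewrite E mulrDr lerD2l.
  by rewrite ler_pM2r// ler_nat leqNgt jk.
have -> : \sum_(0 <= k < j.+1) 'C(n, k)%:R * a ^+ (n - k) *
    gcoef (gpow v k) (k%:R * s + j%:R * d) =
    a ^+ n * \sum_(k < j.+1) 'C(n, k)%:R * g k.
  rewrite big_mkord mulr_sumr; apply: eq_bigr => k _.
  have kn : (k <= n)%N by rewrite -ltnS (leq_trans _ jn).
  have -> : a ^+ n = a ^+ (n - k) * a ^+ k by rewrite -exprD subnK.
  rewrite /g; field.
  by rewrite expf_neq0.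
by rewrite mulf_neq0 ?expf_neq0// hM// (leq_trans _ Mn)// leq_addr.
Qed.

End Powers.

(** * Sets of integers stable under affine maps *)

Section AffineStability.
Context (R : realType).
Implicit Types (lam : nat -> nat).

(** Infinite descent: if [f] is the integral part of [s] and [s != f], then [n
    (s - f)] is a smaller positive integer with the same property. *)
Lemma integral_powers_nat (s : R) (n : nat) : (0 < n)%N -> 0 <= s ->
  (forall m, exists t : nat, n%:R * s ^+ m = t%:R) -> exists t : nat, s = t%:R.
Proof.
move=> n0 s0; have [n' le_nn'] := ubnP n.
elim: n' => // n' IH in n n0 le_nn' * => H.
pose f := Num.truncn s.
have /andP[fs sf] : f%:R <= s < f.+1%:R by apply/truncn_itv.
have [->|sNf] := eqVneq s f%:R; first by exists f.
have {}fs : 0 < s - f%:R by rewrite subr_gt0 lt_neqAle eq_sym sNf.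
have nR : 0 < n%:R :> R by rewrite ltr0n.
have H' m : exists t : nat, n%:R * (s - f%:R) * s ^+ m = t%:R.
  have [t tE] := H m; have [t' t'E] := H m.+1.
  have E : n%:R * (s - f%:R) * s ^+ m = t'%:R - (f * t)%:R.
    by rewrite natrM -tE -t'E exprS; ring.
  exists (t' - f * t)%N; rewrite E natrB// -(ler_nat R) -subr_ge0 -E.
  by rewrite !mulr_ge0 ?exprn_ge0// ltW.
have [k kE] := H' 0; rewrite expr0 mulr1 in kE.
have k0 : (0 < k)%N by rewrite -(ltr0n R) -kE mulr_gt0.
have kn : (k < n)%N.
  rewrite -(ltr_nat R) -kE gtr_pMr// ltrBlDl.
  by rewrite natr1.
apply: (IH k) => //; first by apply: leq_trans kn _; rewrite -ltnS.
by move=> m; rewrite -kE.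
Qed.

(** A progression of [K] terms bounded by [c K] has a sum of reciprocals at
    least [1 / c], while progressions starting far enough lie in a tail whose
    sum is less than [1 / c]. *)
Lemma no_dense_blocks (lam : nat -> nat) (c D : nat) :
  {homo lam : i j / (i < j)%N} -> small_tails R lam -> (0 < c)%N -> (0 < D)%N ->
  (forall X, exists a K, [/\ (0 < K)%N, (X <= a)%N, (a + D * K <= c * K)%N &
     forall t, (t < K)%N -> exists k, (a + t * D)%N = lam k]) -> False.
Proof.
move=> laminc tl c0 D0 blocks.
have lam_le : {mono lam : i j / (i <= j)%N} by exact: leq_mono.
have [N N0 hN] := tl c%:R^-1 ltac:(by rewrite invr_gt0 ltr0n).
have [a [K [K0 Na aK aE]]] := blocks (lam N).
have /boolp.choice[kap kapE] : forall t : 'I_K, exists k, (a + t * D)%N = lam k.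
  by move=> t; exact: aE.
pose n := (\max_(t < K) kap t).+1.
have kn t : (kap t < n)%N by rewrite ltnS leq_bigmax.
pose kap' t : 'I_n := Ordinal (kn t).
have kapI : injective kap'.
  move=> t t' /(congr1 val) /= E; apply: val_inj => /=.
  have := kapE t; rewrite E -kapE => /eqP.
  by rewrite eqn_add2l eqn_pmul2r// => /eqP.
have kapN t : (N <= kap t)%N.
  by rewrite -lam_le -kapE (leq_trans Na)// leq_addr.
have := hN n; rewrite ltNge => /negP; apply.
rewrite big_geq_mkord.
apply: (@le_trans _ _ (\sum_(t < K) (lam (kap' t))%:R^-1)).
  apply: (@le_trans _ _ (\sum_(t < K) (c * K)%:R^-1)).
    rewrite sumr_const card_ord -[leRHS]mulr_natr natrM invfM -mulrA.
    rewrite mulVf ?mulr1//.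
    by rewrite pnatr_eq0 -lt0n.
  apply: ler_sum => t _.
  rewrite lef_pV2 ?posrE ?ltr0n ?muln_gt0 ?c0//=; last first.
    by rewrite (leq_ltn_trans (leq0n (lam 0)))// laminc// (leq_trans N0).
  rewrite ler_nat -kapE (leq_trans _ aK)// leq_add2l mulnC leq_mul2l.
  by rewrite ltnW ?orbT.
rewrite -(big_imset (fun k : 'I_n => (lam k)%:R^-1) (h := kap'))/=; last first.
  by move=> x y _ _; exact: kapI.
rewrite big_mkcond [leRHS]big_mkcond; apply: ler_sum => k _.
case: ifPn => [/imsetP[t _ ->]|_]; first by rewrite kapN.
by case: ifP => // _; rewrite invr_ge0.
Qed.

(** If [S = 1] the maps generate all the [n + t D]. If [S > 1], a number [t < S
    ^ m.+1] is [(t %/ S) * S + t %% S], and the map with [j = t %% S] sends [n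
    S ^ m + (t %/ S) D] to [n S ^ m.+1 + t D]; so by induction all these
    progressions of [S ^ m] terms are in the range, and their terms are at most
    [(n + D) S ^ m]. *)
Lemma affine_closed_dense (lam : nat -> nat) (S D : nat) :
  {homo lam : i j / (i < j)%N} -> small_tails R lam -> (0 < S)%N -> (0 < D)%N ->
  (forall j, exists N, forall k, (N <= lam k)%N ->
     exists k', (lam k * S + j * D)%N = lam k') -> False.
Proof.
move=> laminc tl S0 D0 H.
have lamk k : (k <= lam k)%N.
  by elim: k => // k IH; apply: leq_ltn_trans IH _; exact: laminc.
have {H}HJ J : exists N, forall k j, (N <= lam k)%N -> (j <= J)%N ->
     exists k', (lam k * S + j * D)%N = lam k'.
  elim: J => [|J [N hN]]; [have [N' hN'] := H 0%N|have [N' hN'] := H J.+1].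
    by exists N' => k j Nk; rewrite leqn0 => /eqP ->; exact: hN'.
  exists (maxn N N') => k j; rewrite geq_max => /andP[Nk N'k].
  by rewrite leq_eqVlt => /predU1P[->|jJ]; [exact: hN'|exact: hN].
have [N hN] := HJ S; pose k0 := (maxn N 1); pose n := lam k0.
have nN : (N <= n)%N by rewrite (leq_trans _ (lamk k0))// leq_maxl.
have n0 : (0 < n)%N by rewrite (leq_trans _ (lamk k0))// leq_maxr.
have [S1|S1] := leqP S 1.
  have {S1 S0} S1 : S = 1%N by apply/eqP; rewrite eqn_leq S1.
  have {}hN t : exists k, (n + t * D)%N = lam k.
    elim: t => [|t [k kE]]; first by exists k0; rewrite mul0n addn0.
    rewrite mulSnr addnA kE; have [] := hN k 1%N; rewrite ?S1//.
      by rewrite -kE (leq_trans nN)// leq_addr.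
    by move=> k'; rewrite muln1 mul1n => ->; exists k'.
  apply: (@no_dense_blocks lam (n + 2 * D) D laminc tl) => //.
    by rewrite addn_gt0 n0.
  (* Starting at [n + X.+1 * D] makes the first term at least [X], while the
     last one remains proportional to the number [X.+1] of terms. *)
  move=> X; exists (n + X.+1 * D)%N, X.+1; split => //.
  - rewrite (leq_trans (leqnSn X))// (leq_trans _ (leq_addl _ _))//.
    by rewrite leq_pmulr.
  - by nia.
  - by move=> t _; rewrite -addnA -mulnDl; exact: hN.
have {}hN m : forall t, (t < S ^ m)%N ->
    exists k, (n * S ^ m + t * D)%N = lam k.
  elim: m => [|m IH] t tS.
    by move: tS; rewrite ltnS leqn0 => /eqP ->; exists k0; rewrite muln1 addn0.
  have [] := IH (t %/ S)%N; first by rewrite ltn_divLR// -expnSr.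
  move=> k kE; have [] := hN k (t %% S)%N.
  - rewrite -kE (leq_trans nN)// (leq_trans _ (leq_addr _ _))//.
    by rewrite leq_pmulr// expn_gt0 S0.
  - by rewrite ltnW// ltn_pmod.
  - move=> k' E; exists k'; rewrite -E -kE {1}(divn_eq t S) expnSr; ring.
apply: (@no_dense_blocks lam (n + D) D laminc tl) => //.
  by rewrite addn_gt0 n0.
move=> X; exists (n * S ^ X)%N, (S ^ X)%N; split => //.
- by rewrite expn_gt0 S0.
- by rewrite (leq_trans (ltnW (ltn_expl X S1)))// leq_pmull.
- by rewrite mulnDl.
- exact: hN.
Qed.

End AffineStability.

Theorem theorem2p5 (R : realType) (p : R) (lam : nat -> nat) (l : nat)
    (phi : R -> R) :
  1 <= p ->
  {homo lam : i j / (i < j)%N} ->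
  (\sum_(0 <= k <oo | lam k != 0%N) ((lam k)%:R^-1 : R)%:E < +oo)%E ->
  real_exponent_polynomial l phi ->
  (1 < l)%N ->
  phi @` `[0, 1] `<=` `[0, 1] ->
  composition_not_stable phi (muntz_space p (range lam)).
Proof.
move=> p1 laminc sumlam [c [s [c0 s0 sinj phiE]]] l1 _.
have lamk k : (k <= lam k)%N.
  by elim: k => // k IH; exact: leq_ltn_trans IH (laminc _ _ (ltnSn k)).
have tl := summable_small_tails lamk sumlam.
apply: contrapT => stable.
have phiM n : range lam n ->
    muntz_space p (range lam) ((fun x => x ^+ n) \o phi).
  move=> Ln; apply: contrapT => H; apply: stable.
  exists (fun x => x ^+ n); split => //; first exact: monomial_muntz.
  by apply: continuous_subspaceT; exact: exprn_continuous.
(* [i0] carries the least exponent of [phi] and [i1] the second least one. *)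
pose i00 : 'I_l := Ordinal (ltnW l1).
have [i0 _ i0min] := @Order.TotalTheory.arg_minP _ _ _ i00 xpredT s isT.
have [j0 j0i0] : exists j0, j0 != i0.
  have [->|] := eqVneq i0 i00; last by exists i00; rewrite eq_sym.
  by exists (Ordinal l1).
have [i1 i1i0 i1min] :=
  @Order.TotalTheory.arg_minP _ _ _ j0 (fun i => i != i0) s j0i0.
pose d := s i1 - s i0.
have d0 : 0 < d.
  by rewrite subr_gt0 lt_neqAle i0min// andbT (inj_eq sinj) eq_sym.
have sd : s i0 + d = s i1 by rewrite /d addrC subrK.
pose v := [seq (c i, s i) | i <- index_enum 'I_l & i != i0].
have vsd : {in v, forall m, s i0 + d <= m.2}.
  move=> _ /mapP[i + ->] /=; rewrite mem_filter sd => /andP[ii0 _].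
  exact: i1min.
have v0 : {in v, forall m, 0 <= m.2}.
  by move=> _ /mapP[i _ ->]; exact: (ltW (s0 i)).
have vc : gcoef v (s i0 + d) != 0.
  rewrite /gcoef big_map big_filter_cond sd /= (big_pred1 i1)// => i.
  rewrite /= (inj_eq sinj).
  by case: (eqVneq i i1) => [->|]; rewrite ?i1i0 ?andbF.
have phiv x : x \in `[0, 1] -> phi x = c i0 * x `^ s i0 + geval v x.
  by move=> x01; rewrite phiE// (bigD1 i0)//= /geval big_map big_filter.
have key j : exists M, forall k, (M * j <= lam k)%N ->
    exists k', (lam k)%:R * s i0 + j%:R * d = (lam k')%:R.
  have [M hM] := gcoef_gbinom_neq0 j (c0 i0) vsd d0 vc.
  exists M => k Mk; apply: (muntz_exponent p1 tl lamk _ _ _ (hM _ Mk)).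
  - by apply: gbinom_ge0 => //; exact: ltW.
  - by apply: phiM; exists k.
  - by move=> x x01; rewrite geval_gbinom ?ltW//= phiv.
(* For [j = 0] there is no lower bound on [lam k], so multiplication by [s i0]
   preserves the range and can be iterated. *)
have [S SE] : exists S : nat, s i0 = S%:R.
  have lam1 : (0 < lam 1)%N by exact: leq_trans (lamk 1).
  apply: (integral_powers_nat lam1); first exact: ltW.
  have [M hM] := key 0%N.
  suff H m : exists k, (lam 1)%:R * s i0 ^+ m = (lam k)%:R.
    by move=> m; have [k kE] := H m; exists (lam k).
  elim: m => [|m [k kE]]; first by exists 1%N; rewrite expr0 mulr1.
  have [] := hM k; first by rewrite muln0.
  by move=> k' k'E; exists k'; rewrite -k'E mul0r addr0 -kE exprSr mulrA.
have [D DE] : exists D : nat, d = D%:R.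
  have [M hM] := key 1%N; have [] := hM M; first by rewrite muln1.
  move=> k; rewrite mul1r SE -natrM => E.
  have dE : d = (lam k)%:R - (lam M * S)%:R by rewrite -E addrAC subrr add0r.
  exists (lam k - lam M * S)%N; rewrite natrB//.
  by rewrite -(ler_nat R) -subr_ge0 -dE ltW.
apply: (@affine_closed_dense R lam S D) => //.
- by rewrite -(ltr0n R) -SE.
- by rewrite -(ltr0n R) -DE.
- move=> j; have [M hM] := key j; exists (M * j)%N => k /hM[k' k'E].
  exists k'; apply/eqP; rewrite -(eqr_nat R) -k'E natrD !natrM -SE -DE.
  exact/eqP.
Qed.
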